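(* Let $(X,d)$ be a compact metric space and let $\phi$ be a continuous flow on $X$. If $\phi$ is transitive, then $Sh^+(\phi)=X$ or $Sh^+(\phi)=\emptyset$.
   Context: A flow on $X$ is a map $\phi:X\times\mathbb{R}\to X$ with $\phi(x,0)=x$ and $\phi(\phi(x,s),t)=\phi(x,s+t)$, assumed continuous; $\phi_t(x)=\phi(x,t)$. The flow is transitive if there is $x\in X$ with $\omega(x)=X$, where $\omega(x)=\{y\in X: y=\lim_{n\to\infty}\phi_{t_n}(x)\text{ for some sequence }t_n\to+\infty\}$. Given $\delta,T>0$, a forward $(\delta,T)$-pseudo-orbit is a sequence $(x_i,t_i)_{i=0}^\infty$ in $X\times\mathbb{R}$ with $t_i\ge T$ and $d(\phi_{t_i}(x_i),x_{i+1})\le\delta$ for all $i\ge0$; it passes through $p$ if $x_0=p$. Put $s_0=0$, $s_i=\sum_{j=0}^{i-1}t_j$ for $i>0$, and $x_0\star t=\phi_{t-s_i}(x_i)$ whenever $s_i\le t<s_{i+1}$ ($t\ge0$). $\mathrm{Rep}$ is the set of surjective strictly increasing maps $h:\mathbb{R}\to\mathbb{R}$ with $h(0)=0$. The forward pseudo-orbit is $\varepsilon$-shadowed if there are $y\in X$ and $h\in\mathrm{Rep}$ with $d(x_0\star t,\phi_{h(t)}(y))\le\varepsilon$ for all $t\ge0$. $Sh^+(\phi)$ (the set of forward shadowable points) is the set of $p\in X$ such that for every $\varepsilon>0$ there is $\delta>0$ such that every forward $(\delta,1)$-pseudo-orbit passing through $p$ is $\varepsilon$-shadowed. *)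

(* Defs.v *)
From HB Require Import structures.
From mathcomp Require Import all_boot all_order all_algebra.
From mathcomp Require Import all_classical all_reals all_analysis.

Set Implicit Arguments.
Unset Strict Implicit.
Unset Printing Implicit Defensive.

Import Order.TTheory GRing.Theory Num.Theory.
Import numFieldNormedType.Exports.

Local Open Scope classical_set_scope.
Local Open Scope ring_scope.

Section ForwardShadowing.
Context {R : realType} {X : metricType R}.
Implicit Types (phi : X * R -> X) (x y p : X) (xs : nat -> X) (ts : nat -> R).

Definition flow phi :=
  (forall x, phi (x, 0) = x) /\
  (forall x s t, phi (phi (x, s), t) = phi (x, s + t)).

Definition omega_limit phi x : set X :=
  [set y | exists ts, ts @ \oo --> +oo /\ phi (x, ts n) @[n --> \oo] --> y].

Definition transitive_flow phi := exists x, omega_limit phi x = [set: X].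

Definition forward_pseudo_orbit phi (delta T : R) xs ts :=
  forall i, T <= ts i /\ mdist (phi (xs i, ts i)) (xs i.+1) <= delta.

Definition passes_through xs p := xs 0%N = p.

Definition switch_time ts (i : nat) : R := \sum_(j < i) ts j.

(* When ts is bounded below by a positive real, each t >= 0 lies in exactly one
   interval [switch_time ts i, switch_time ts i.+1[ (see pseudo_orbit_indexP and
   pseudo_orbit_atE); otherwise the default index 0 is irrelevant. *)
Definition pseudo_orbit_index ts (t : R) : nat :=
  xget 0%N [set i | switch_time ts i <= t < switch_time ts i.+1].

Definition pseudo_orbit_at phi xs ts (t : R) : X :=
  let i := pseudo_orbit_index ts t in phi (xs i, t - switch_time ts i).

Definition Rep : set (R -> R) :=
  [set h | [/\ set_surj [set: R] [set: R] h, {homo h : s t / s < t} & h 0 = 0]].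

Definition forward_shadowed phi (eps : R) xs ts :=
  exists y (h : R -> R), Rep h /\
    forall t, 0 <= t -> mdist (pseudo_orbit_at phi xs ts t) (phi (y, h t)) <= eps.

Definition forward_shadowable phi : set X :=
  [set p | forall eps : R, 0 < eps -> exists2 delta : R, 0 < delta &
     forall xs ts, forward_pseudo_orbit phi delta 1 xs ts ->
       passes_through xs p -> forward_shadowed phi eps xs ts].

Lemma switch_timeS ts i : switch_time ts i.+1 = switch_time ts i + ts i.
Proof. by rewrite /switch_time big_ord_recr. Qed.

Lemma switch_time_le ts (T : R) i j : 0 < T -> (forall k, T <= ts k) ->
  (i <= j)%N -> switch_time ts i <= switch_time ts j.
Proof.
move=> T0 Tts; elim: j => [|j IH]; first by rewrite leqn0 => /eqP ->.
rewrite leq_eqVlt => /predU1P[-> //|/IH /le_trans]; apply.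
by rewrite switch_timeS lerDl (le_trans (ltW T0)).
Qed.

Lemma pseudo_orbit_indexP ts (T t : R) : 0 < T -> (forall k, T <= ts k) ->
  0 <= t -> let i := pseudo_orbit_index ts t in
  switch_time ts i <= t < switch_time ts i.+1.
Proof.
move=> T0 Tts t0 /=; rewrite /pseudo_orbit_index.
case: xgetP => [i _ //|none]; exfalso.
have below i : switch_time ts i <= t.
  elim: i => [|i IH]; first by rewrite /switch_time big_ord0.
  by rewrite leNgt; apply/negP => lt; apply: (none i); rewrite /= IH lt.
have lin i : T *+ i <= switch_time ts i.
  elim: i => [|i IH]; first by rewrite mulr0n /switch_time big_ord0.
  by rewrite switch_timeS mulrSr lerD.
have := archi_boundP (divr_ge0 t0 (ltW T0)); set n := Num.bound _.
rewrite ltr_pdivrMr// mulr_natl ltNge => /negP; apply.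
exact: le_trans (lin n) (below n).
Qed.

Lemma pseudo_orbit_atE phi xs ts (T t : R) i : 0 < T -> (forall k, T <= ts k) ->
  switch_time ts i <= t < switch_time ts i.+1 ->
  pseudo_orbit_at phi xs ts t = phi (xs i, t - switch_time ts i).
Proof.
move=> T0 Tts /andP[it ti].
have t0 : 0 <= t.
  apply: le_trans it; have := switch_time_le T0 Tts (leq0n i).
  by rewrite {1}/switch_time big_ord0.
have := pseudo_orbit_indexP T0 Tts t0; rewrite /pseudo_orbit_at /=.
set j := pseudo_orbit_index ts t => /andP[jt tj].
suff -> : j = i by [].
apply/eqP; rewrite eqn_leq; apply/andP; split; rewrite leqNgt; apply/negP.
  by move=> /(switch_time_le T0 Tts)/(lt_le_trans ti); rewrite ltNge jt.
by move=> /(switch_time_le T0 Tts)/(lt_le_trans tj); rewrite ltNge it.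
Qed.

End ForwardShadowing.

(* Main.v *)
Require Import Defs.
From mathcomp Require Import all_boot all_order all_algebra.
From mathcomp Require Import all_classical all_reals all_analysis.
Import numFieldNormedType.Exports.
Local Open Scope classical_set_scope.
Local Open Scope ring_scope.

Import Order.TTheory GRing.Theory Num.Theory.

Set Implicit Arguments.
Unset Strict Implicit.

(** Forward shadowability propagates along chains. Suppose that [p] is
forward shadowable, let [delta] be associated with [eps] at [p], and consider
a [(delta, 1)]-pseudo-orbit through another point [q]. Along the orbit of a
point whose omega-limit set is the whole space there is a piece of length at
least [1] that starts [delta]-close to [phi (p, 1)] and ends [delta]-close to
[q] ([transitive_chain]). Following [p] for unit time, then this piece, then
the given pseudo-orbit yields a [(delta, 1)]-pseudo-orbit through [p], which is
[eps]-shadowed by the choice of [delta]. A shadowing orbit of a pseudo-orbit,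
with its reparametrization restarted at the first jump, shadows what comes
after that jump ([forward_shadowed_tail]); removing the first two pieces shows
that the given pseudo-orbit is [eps]-shadowed. So one [delta] works for all
points at once, and one shadowable point makes every point shadowable. *)

Lemma switch_time_tail (R : realType) (ts : nat -> R) i :
  switch_time ts i.+1 = ts 0%N + switch_time (fun j => ts j.+1) i.
Proof. by rewrite /switch_time big_ord_recl. Qed.

Lemma pseudo_orbit_at_tail (R : realType) (X : metricType R)
    (phi : X * R -> X) (xs : nat -> X) (ts : nat -> R) (T t : R) :
    0 < T -> (forall i, T <= ts i) -> 0 <= t ->
  pseudo_orbit_at phi xs ts (ts 0%N + t) =
  pseudo_orbit_at phi (fun i => xs i.+1) (fun i => ts i.+1) t.
Proof.
move=> T0 Tts t0.
have /= := pseudo_orbit_indexP T0 (fun i => Tts i.+1) t0.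
set i := pseudo_orbit_index _ t => it.
rewrite (pseudo_orbit_atE phi (fun i => xs i.+1) T0 (fun i => Tts i.+1) it).
rewrite (pseudo_orbit_atE phi xs T0 Tts (i := i.+1)).
  by rewrite switch_time_tail opprD addrACA subrr add0r.
by rewrite !(switch_time_tail ts) lerD2l ltrD2l.
Qed.

Lemma Rep_restart (R : realType) (h : R -> R) (a : R) :
  Rep h -> Rep (fun t => h (a + t) - h a).
Proof.
move=> [hsurj hincr _]; split => [y _|s t st|]; last by rewrite addr0 subrr.
- have [s _ hs] := hsurj (y + h a) I.
  by exists (s - a) => //; rewrite [a + _]addrC subrK hs addrK.
- by rewrite ltrD2r hincr// ltrD2l.
Qed.

(** If [y] and [h] shadow the pseudo-orbit and [a] is its first jump time, then
[phi (y, h a)] and [h] restarted at [a] shadow the rest, because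
[phi (phi (y, h a), h (a + t) - h a) = phi (y, h (a + t))]. *)
Lemma forward_shadowed_tail (R : realType) (X : metricType R)
    (phi : X * R -> X) (eps T : R) (xs : nat -> X) (ts : nat -> R) :
    flow phi -> 0 < T -> (forall i, T <= ts i) ->
    forward_shadowed phi eps xs ts ->
  forward_shadowed phi eps (fun i => xs i.+1) (fun i => ts i.+1).
Proof.
move=> [_ phiD] T0 Tts [y [h [hRep sh]]].
exists (phi (y, h (ts 0%N))), (fun t => h (ts 0%N + t) - h (ts 0%N)).
split=> [|t t0]; first exact: Rep_restart.
rewrite phiD [h _ + _]addrC subrK -(pseudo_orbit_at_tail phi xs T0 Tts t0).
by rewrite sh// addr_ge0// (le_trans (ltW T0)).
Qed.

Lemma forward_pseudo_orbit_cons (R : realType) (X : metricType R)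
    (phi : X * R -> X) (delta T : R) (x : X) (t : R)
    (xs : nat -> X) (ts : nat -> R) :
    T <= t -> mdist (phi (x, t)) (xs 0%N) <= delta ->
    forward_pseudo_orbit phi delta T xs ts ->
  forward_pseudo_orbit phi delta T
    (fun i => if i is j.+1 then xs j else x)
    (fun i => if i is j.+1 then ts j else t).
Proof. by move=> Tt xt xsts [|i] /=; [split | exact: xsts]. Qed.

Lemma omega_limit_close (R : realType) (X : metricType R)
    (phi : X * R -> X) (x y : X) (s delta : R) :
    omega_limit phi x y -> 0 < delta ->
  exists2 t, s <= t & mdist (phi (x, t)) y <= delta.
Proof.
move=> [ts [ts_oo tsy]] delta0.
have /filter_ex[n [sn ny]] : \forall n \near \oo,
    s <= ts n /\ mdist y (phi (x, ts n)) <= delta.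
  apply: filterI; first by move/cvgryPge: ts_oo; apply.
  exact: (metricType_numDomainType.cvgr_dist_le tsy).
by exists (ts n) => //; rewrite metric_sym.
Qed.

(** The orbit of a point [x] with full omega-limit set comes close to
[phi (p, 1)] at some time [s], and close to [q] at arbitrarily late times, hence
at some [t >= s + 1]; the chain uses the piece of orbit between [s] and [t]. *)
Lemma transitive_chain (R : realType) (X : metricType R)
    (phi : X * R -> X) (p q : X) (delta : R) :
    flow phi -> transitive_flow phi -> 0 < delta ->
  exists z u, [/\ 1 <= u, mdist (phi (p, 1)) z <= delta &
                  mdist (phi (z, u)) q <= delta].
Proof.
move=> [_ phiD] [x omegax] delta0.
have [s _ ps] : exists2 s, 0 <= s & mdist (phi (x, s)) (phi (p, 1)) <= delta.
  by apply: omega_limit_close => //; rewrite omegax.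
have [t st tq] : exists2 t, s + 1 <= t & mdist (phi (x, t)) q <= delta.
  by apply: omega_limit_close => //; rewrite omegax.
exists (phi (x, s)), (t - s); split; first by rewrite lerBrDl.
- by rewrite metric_sym.
- by rewrite phiD [s + _]addrC subrK.
Qed.

Theorem corollary2p13 (R : realType) (X : metricType R) (phi : X * R -> X)
    (X_compact : compact [set: X])
    (phi_flow : flow phi) (phi_continuous : continuous phi)
    (phi_transitive : transitive_flow phi) :
  forward_shadowable phi = [set: X] \/ forward_shadowable phi = set0.
Proof.
have [->|/set0P[p p_sh]] := eqVneq (forward_shadowable phi) set0; first by right.
left; apply/seteqP; split=> // q _ eps /p_sh[delta delta0 sh].
exists delta => // xs ts xsts xs0.
have [z [u [u1 pz zq]]] := transitive_chain p q phi_flow phi_transitive delta0.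
rewrite -xs0 in zq.
have zxs := forward_pseudo_orbit_cons u1 zq xsts.
have pzxs := forward_pseudo_orbit_cons (lexx 1) pz zxs.
have := sh _ _ pzxs erefl.
move=> /(forward_shadowed_tail phi_flow ltr01 (fun i => (pzxs i).1)).
exact: (forward_shadowed_tail phi_flow ltr01 (fun i => (zxs i).1)).
Qed.
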